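(* Let $\ell > 2$ be an even integer. Suppose $n = 2\ell + \alpha$, where $\alpha = \beta(\ell+2) + \gamma\ell$ for some nonnegative integers $\beta,\gamma$. Then the honeycomb toroidal graph $\mathrm{HTG}(2,n,\ell)$ is 2-spanning cyclable.
   Context: For integers $m\ge 1$, $\ell\ge 0$ and $n\ge 4$ with $n$ even and $m-\ell$ even, the honeycomb toroidal graph $\mathrm{HTG}(m,n,\ell)$ is the simple graph with vertex set $\{u_{i,j}: 0\le i\le m-1,\ 0\le j\le n-1\}$ (first subscript computed modulo $m$, second modulo $n$) whose edge set is the set of the following unordered pairs: $\{u_{i,j},u_{i,j+1}\}$ for all $i,j$ (vertical edges); $\{u_{i,j},u_{i+1,j}\}$ for all $0\le i\le m-2$ with $i+j$ odd (flat edges); and $\{u_{m-1,j},u_{0,j+\ell}\}$ for all $j$ having the same parity as $m$ (and $\ell$) (jump edges). A 2-factor of a graph is a spanning subgraph in which every vertex has valency 2. A graph $X$ is 2-spanning cyclable if for every pair of distinct vertices $u,v$ of $X$ there is a 2-factor of $X$ consisting of exactly two cycles such that $u$ and $v$ lie in different cycles. *)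

(* Defs.v *)
From mathcomp Require Import all_boot.
Set Implicit Arguments.
Unset Strict Implicit.
Unset Printing Implicit Defensive.

(* Simple graphs on a finType are symmetric irreflexive boolean relations. *)
Definition simple_graph (T : finType) (e : rel T) : Prop :=
  symmetric e /\ irreflexive e.

Definition valency (T : finType) (e : rel T) (x : T) : nat :=
  #|[set y | e x y]|.

Definition two_factor (T : finType) (e f : rel T) : Prop :=
  [/\ simple_graph f, subrel f e & forall x, valency f x = 2].

(* Duplicate-free closed walk; the bound excludes the degenerate sequences
   [:: x] and [:: x; y] that ucycle allows. *)
Definition graph_cycle (T : finType) (e : rel T) (c : seq T) : Prop :=
  ucycle e c /\ 2 < size c.

(* The undirected edges traversed by the cyclic sequence c. *)
Definition cycle_edge (T : finType) (c : seq T) : rel T :=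
  [rel x y | (x \in c) && (y == next c x) || (y \in c) && (x == next c y)].

Definition consists_of_two_cycles (T : finType) (f : rel T) (c1 c2 : seq T)
    : Prop :=
  [/\ graph_cycle f c1, graph_cycle f c2, [disjoint c1 & c2]
    & f =2 [rel x y | cycle_edge c1 x y || cycle_edge c2 x y]].

Definition two_spanning_cyclable (T : finType) (e : rel T) : Prop :=
  forall u v : T, u != v ->
  exists f : rel T, two_factor e f /\
  exists c1 c2 : seq T,
    [/\ consists_of_two_cycles f c1 c2, u \in c1 & v \in c2].

(* The vertex u_{i,j} is the pair (i, j); each family of edges is first given
   with the orientation used in its definition, then symmetrized. *)
Section HoneycombToroidalGraph.
Variables m n l : nat.
Implicit Types x y : 'I_m * 'I_n.

Definition vertical_arc x y : bool := (y.1 == x.1) && (y.2 == ordS x.2).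

(* i <= m - 2 is implied by y.1 < m. *)
Definition flat_arc x y : bool :=
  [&& y.1 == x.1.+1 :> nat, y.2 == x.2 & odd (x.1 + x.2)].

Definition jump_arc x y : bool :=
  [&& x.1 == m.-1 :> nat, y.1 == 0 :> nat, odd x.2 == odd m
    & y.2 == (x.2 + l) %% n :> nat].

Definition HTG_arc x y : bool :=
  [|| vertical_arc x y, flat_arc x y | jump_arc x y].

Definition HTG : rel ('I_m * 'I_n) := [rel x y | HTG_arc x y || HTG_arc y x].

Lemma HTG_simple : 0 < m -> 3 < n -> ~~ odd n -> odd m = odd l ->
  simple_graph HTG.
Proof.
move=> m_gt0 n_gt3 n_even ml_par; split=> [x y|[i j]]; rewrite /HTG /=.
  by rewrite orbC.
rewrite orbb /HTG_arc /vertical_arc /flat_arc /jump_arc /= eqxx /=.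
have /negPf-> : j != ordS j.
  apply/eqP=> /(congr1 val) /=; have := ltn_ord j.
  rewrite leq_eqVlt => /orP[/eqP jn | jn]; last by rewrite modn_small //; apply: n_Sn.
  by rewrite jn modnn => j0; rewrite -jn j0 in n_gt3.
have /negPf-> /= : i != i.+1 :> nat by rewrite neq_ltn ltnSn.
apply/negP=> /and4P[/eqP im /eqP i0 _ /eqP jl].
have m1 : m = 1 by rewrite -(prednK m_gt0) -im i0.
have := congr1 odd jl; rewrite odd_mod; last exact: negPf.
by rewrite oddD -ml_par m1 addbT; case: (odd j).
Qed.

End HoneycombToroidalGraph.

Arguments HTG m n l : clear implicits.

(* Main.v *)
(* Write a_x and b_x for the vertices of the two columns in row o + x, where o
   is odd.  The short cycle goes up a_1, ..., a_(l-1), jumps to b_(n-1), goes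
   down to b_(n-l+1) and jumps back to a_1.  The other vertices form one long
   cycle: up b_0, ..., b_(l-1), then through consecutive detours, each visiting
   l + 2 or l full rows and returning to the second column, up to b_(n-l), across
   to a_(n-l), up to a_(n-1), and back through a_0 to b_0; this is where
   n - 2l has to be a sum of copies of l + 2 and l.  In each column the short
   cycle meets an interval of l - 1 rows, and a suitable o puts it around just
   one of two given vertices.  Vertices in different columns are separated by
   the two vertical cycles. *)
Require Import Defs.
From mathcomp Require Import all_boot zify.
Set Implicit Arguments.
Unset Strict Implicit.
Unset Printing Implicit Defensive.

(** * Two-factors from a covering pair of cycles *)

Section TwoFactorsFromCycles.
Variables (T : finType) (e : rel T).

(** Applying [next] to both sides, equality would mean that two steps forward from [x] lead back to
    [x]; rotating the cycle to start at [x] excludes this. *)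
Lemma next_neq_prev (c : seq T) x :
  uniq c -> 2 < size c -> x \in c -> next c x != prev c x.
Proof.
move=> Uc c_gt2 /rot_to[i s def_s].
rewrite -(can_eq (prev_next Uc)) (next_prev Uc) -!(next_rot i Uc) def_s.
have: uniq (x :: s) by rewrite -def_s rot_uniq.
have: 2 < size (x :: s) by rewrite -def_s size_rot.
case: s {def_s} => [|y [|z s]] //= _ /andP[]; rewrite !inE !eqxx.
by rewrite !negb_or eq_sym => /andP[/negPf-> /andP[xz _]] _; rewrite eq_sym.
Qed.

Lemma cycle_edge_neighbours (c : seq T) x :
  uniq c -> x \in c -> cycle_edge c x =i [set next c x; prev c x].
Proof.
move=> Uc xc y; rewrite !inE [LHS]/(_ || _) xc /=; congr (_ || _).
apply/andP/eqP => [[_ /eqP->] | ->]; first by rewrite prev_next.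
by rewrite mem_prev next_prev.
Qed.

Lemma cycle_edge_mem (c : seq T) x y : cycle_edge c x y -> x \in c.
Proof. by case/orP=> /andP[yc /eqP xy]; rewrite ?xy ?mem_next. Qed.

Lemma cycle_edge_next (c : seq T) x : x \in c -> cycle_edge c x (next c x).
Proof. by move=> xc; rewrite /cycle_edge /= xc eqxx. Qed.

Lemma cycle_edge_sym (c : seq T) : symmetric (cycle_edge c).
Proof. by move=> x y; rewrite /cycle_edge /= orbC. Qed.

Lemma cycle_edge_sub (c : seq T) :
  symmetric e -> cycle e c -> subrel (cycle_edge c) e.
Proof.
move=> e_sym e_c x y /orP[] /andP[zc /eqP->]; last rewrite e_sym.
  exact: next_cycle.
exact: next_cycle.
Qed.

(** Take the union of the edges of both cycles. At a vertex of one cycle the other contributes no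
    edge, so the neighbours are the successor and the predecessor, which differ. *)
Lemma two_factor_of_cycles (c1 c2 : seq T) :
    simple_graph e -> cycle e c1 -> cycle e c2 ->
    2 < size c1 -> 2 < size c2 -> uniq (c1 ++ c2) ->
    (forall x, x \in c1 ++ c2) ->
  exists f : rel T, two_factor e f /\ consists_of_two_cycles f c1 c2.
Proof.
move=> [e_sym e_irr] e_c1 e_c2 c1_gt2 c2_gt2; rewrite cat_uniq.
case/and3P=> Uc1 c12 Uc2 c_cover.
pose f := [rel x y | cycle_edge c1 x y || cycle_edge c2 x y].
have f_e : subrel f e by move=> x y /orP[]; apply: cycle_edge_sub.
have valency_cycle c : uniq c -> 2 < size c ->
    (forall x, x \in c -> f x =1 cycle_edge c x) ->
  forall x, x \in c -> valency f x = 2.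
- move=> Uc c_gt2 f_c x xc.
  have -> : valency f x = #|[set next c x; prev c x]|.
    by apply: eq_card => y; rewrite -cycle_edge_neighbours // inE; apply: f_c.
  by rewrite cards2 next_neq_prev.
exists f; split; first split => //.
- split=> [x y | x]; first by rewrite /f /= !(cycle_edge_sym _ x).
  by apply: contraFF (e_irr x) => /f_e.
- move=> x; have := c_cover x; rewrite mem_cat => /orP[].
    apply: valency_cycle => // {}x xc y; rewrite /f /=.
    case: (boolP (cycle_edge c2 x y)) => [/cycle_edge_mem xc2|_].
      by case/hasP: c12; exists x.
    by rewrite orbF.
  apply: valency_cycle => // {}x xc y; rewrite /f /=.
  case: (boolP (cycle_edge c1 x y)) => [/cycle_edge_mem xc1|//].
  by case/hasP: c12; exists x.
split=> //.
- split=> //; apply/andP; split=> //; apply: cycle_from_next => // x xc.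
  by rewrite /f /= cycle_edge_next.
- split=> //; apply/andP; split=> //; apply: cycle_from_next => // x xc.
  by rewrite /f /= cycle_edge_next ?orbT.
- by rewrite disjoint_sym disjoint_has; apply: contra c12.
Qed.

End TwoFactorsFromCycles.

(** * Runs of consecutive rows in one column *)

Section Runs.
Variables (T : eqType) (e : rel T) (f : nat -> T).
Hypotheses (e_sym : symmetric e) (f_path : forall x, e (f x) (f x.+1)).

Definition up a k := [seq f x | x <- iota a k].
Definition down a k := rev (up a k).

Lemma size_up a k : size (up a k) = k.
Proof. by rewrite size_map size_iota. Qed.

Lemma mem_up a k x : a <= x < a + k -> f x \in up a k.
Proof. by rewrite -mem_iota; apply: map_f. Qed.

Lemma last_up a k u : 0 < k -> last u (up a k) = f (a + k).-1.
Proof.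
by case: k => // k _; rewrite /up -addn1 iotaD map_cat last_cat addn1 addnS.
Qed.

Lemma path_up a k u s : 0 < k ->
  path e u (up a k ++ s) = e u (f a) && path e (f (a + k).-1) s.
Proof.
case: k => // k _; elim: k a u => [|k IHk] a u; first by rewrite addn1.
rewrite -[up a _]/(f a :: up a.+1 k.+1) cat_cons.
have -> p : path e u (f a :: p) = e u (f a) && path e (f a) p by [].
by rewrite IHk f_path addSnnS.
Qed.

Lemma path_down a k u s : 0 < k ->
  path e u (down a k ++ s) = e u (f (a + k).-1) && path e (f a) s.
Proof.
case: k => // k _; elim: k a u s => [|k IHk] a u s; first by rewrite addn1.
rewrite /down -[up a _]/(f a :: up a.+1 k.+1) rev_cons cat_rcons.
by rewrite IHk /= (e_sym (f a.+1)) f_path !addnS.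
Qed.

Lemma cycle_up k : 1 < k -> f k = f 0 -> cycle e (up 0 k).
Proof.
case: k => [|[|k]] // _ fk.
have -> : cycle e (up 0 k.+2) = path e (f 0) (up 1 k.+1 ++ [:: f 0]).
  by rewrite cats1.
by rewrite path_up //= f_path -fk f_path.
Qed.

End Runs.

(** * The short and the long cycle in a ladder whose rows are not reduced modulo [n] *)

Section Ladder.
Variables (T : finType) (e : rel T) (a b : nat -> T) (l n : nat).
Hypotheses (e_simple : simple_graph e).
Hypotheses (a_path : forall x, e (a x) (a x.+1)).
Hypotheses (b_path : forall x, e (b x) (b x.+1)).
Hypotheses (flat : forall x, ~~ odd x -> e (a x) (b x)).
Hypotheses (jump : forall x, odd x -> e (b x) (a (x + l))).
Hypotheses (a_mod : forall x, a (x + n) = a x).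
Hypotheses (l_gt2 : 2 < l) (l_even : ~~ odd l).

Let e_sym : symmetric e. Proof. by case: e_simple. Qed.

Fixpoint width (ts : seq bool) : nat :=
  if ts is t :: ts' then (if t then l + 2 else l) + width ts' else 0.

(* Each detour exhausts the a_x and b_x with o <= x < o + (l + 2) or
   o <= x < o + l, entering from b_(o-1) and leaving at the topmost b_x. *)
Fixpoint detours (ts : seq bool) (o : nat) : seq T :=
  match ts with
  | [::] => b o :: up a o l
  | true :: ts' =>
      b o :: up a o (l + 2) ++ up b o.+1 (l + 1) ++ detours ts' (o + (l + 2))
  | false :: ts' => down a o l ++ up b o l ++ detours ts' (o + l)
  end.

Lemma size_detours ts o : size (detours ts o) = (width ts + width ts + l).+1.
Proof.
elim: ts o => [|[] ts IHts] o /=; rewrite ?size_cat ?size_rev ?size_up ?IHts; lia.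
Qed.

Lemma last_detours ts o u : last u (detours ts o) = a (o + width ts + l).-1.
Proof.
elim: ts o u => [|[] ts IHts] o u /=; rewrite ?last_cat ?IHts ?addnA //.
by rewrite last_up ?addn0 //; lia.
Qed.

(** A wide detour crosses to the first column, climbs to row [p + l + 2] and jumps back to row
    [p + 2]. A narrow one jumps to row [p + l], descends and crosses back at row [p + 1]. Both
    widths are even, so the next detour is again entered from an odd row. *)
Lemma path_detours ts p : odd p -> path e (b p) (detours ts p.+1).
Proof.
have l_gt0 : 0 < l by lia.
elim: ts p => [|[] ts IHts] p p_odd /=.
- rewrite b_path -[up _ _ _]cats0 (path_up a_path) //= andbT e_sym flat //.
  by rewrite /= p_odd.
- rewrite b_path (path_up a_path) ?addn_gt0 ?l_gt0 // (path_up b_path);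
    rewrite ?addn_gt0 ?l_gt0 //.
  rewrite e_sym flat /= ?p_odd //; apply/andP; split.
    rewrite e_sym; have := @jump p.+2 _.
    by rewrite !addSn !addnS addn0 /= p_odd; apply.
  by rewrite !addSn !addnS addn0 /=; apply: IHts; lia.
- rewrite (path_down e_sym a_path) // (path_up b_path) //= flat /= ?p_odd //.
  by rewrite jump //=; rewrite addSn; apply: IHts; lia.
Qed.

Lemma mem_detours_a ts o x :
  o <= x < o + width ts + l -> a x \in detours ts o.
Proof.
elim: ts o => [|[] ts IHts] o /= o_x; rewrite ?inE ?mem_cat.
- by rewrite mem_up ?orbT //; lia.
- case: (ltnP x (o + (l + 2))) => x_o; first by rewrite mem_up ?orbT //; lia.
  by rewrite IHts ?orbT //; lia.
- rewrite mem_rev; case: (ltnP x (o + l)) => x_o; first by rewrite mem_up //; lia.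
  by rewrite IHts ?orbT //; lia.
Qed.

Lemma mem_detours_b ts o x : o <= x <= o + width ts -> b x \in detours ts o.
Proof.
elim: ts o => [|[] ts IHts] o /= o_x; rewrite ?inE ?mem_cat.
- have -> : x = o by lia.
  by rewrite eqxx.
- case: (ltnP x (o + (l + 2))) => x_o; last by rewrite IHts ?orbT //; lia.
  case: (x =P o) => [->|x_neq]; first by rewrite eqxx.
  by rewrite [b x \in up b _ _]mem_up /= ?orbT //; lia.
- case: (ltnP x (o + l)) => x_o; last by rewrite IHts ?orbT //; lia.
  by rewrite [b x \in up b _ _]mem_up /= ?orbT //; lia.
Qed.

Definition short_cycle := up a 1 l.-1 ++ down b (n - l).+1 l.-1.

Lemma mem_short_a x : 0 < x < l -> a x \in short_cycle.
Proof. by move=> x_l; rewrite mem_cat mem_up //; lia. Qed.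

Lemma mem_short_b x : n - l < x < n -> b x \in short_cycle.
Proof. by move=> x_l; rewrite mem_cat mem_rev orbC mem_up //; lia. Qed.

Variable ts : seq bool.
Hypothesis n_def : n = l + width ts + l.

Definition long_cycle := a 0 :: up b 0 l ++ detours ts l.

Lemma mem_long_a x : l <= x <= n -> a x \in long_cycle.
Proof.
(* Row [n] of the first column is row 0, where the long cycle starts. *)
move=> x_l; rewrite inE mem_cat; case: (x =P n) => [->|x_n].
  by rewrite -(a_mod 0) add0n eqxx.
by rewrite mem_detours_a ?orbT //; lia.
Qed.

Lemma mem_long_b x : x <= n - l -> b x \in long_cycle.
Proof.
move=> x_l; rewrite inE mem_cat; case: (ltnP x l) => lx.
  by rewrite [b x \in up b _ _]mem_up /= ?orbT //; lia.
by rewrite mem_detours_b ?orbT //; lia.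
Qed.

Hypotheses (n_even : ~~ odd n) (T_card : #|T| = n + n).
Hypotheses (T_cover : forall z, exists2 x, x < n & z = a x \/ z = b x).

Lemma short_cycle_cycle : cycle e short_cycle.
Proof.
rewrite /short_cycle; have -> : up a 1 l.-1 = a 1 :: up a 2 l.-2.
  by case: (l) l_gt2 => [|[|k]].
rewrite cat_cons /= rcons_cat -cats1 (path_up a_path); last by lia.
rewrite a_path (path_down e_sym b_path) /= ?andbT; last by lia.
(* Both jumps wrap around: in unreduced rows they join [b (n - l + 1)] to [a (n + 1)] and
   [b (n - 1)] to [a (n + l - 1)]. *)
apply/andP; split; last first.
  rewrite -[a 1]a_mod; have -> : 1 + n = (n - l).+1 + l by lia.
  by apply: jump; lia.
rewrite -[a _]a_mod.
have -> : (2 + l.-2).-1 + n = n.-1 + l by lia.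
have -> : n - l + l.-1 = n.-1 by lia.
by rewrite e_sym jump //; lia.
Qed.

Lemma long_cycle_cycle : cycle e long_cycle.
Proof.
have l_pred : l.-1.+1 = l by lia.
have := @path_detours ts l.-1; rewrite l_pred => detours_path.
rewrite /long_cycle /= rcons_path last_cat last_detours -n_def.
rewrite (path_up b_path) ?add0n ?flat ?detours_path; try lia.
(* The closing edge goes from [a (n - 1)] to [a n], which is [a 0]. *)
by have := a_path n.-1; rewrite -(a_mod 0) add0n prednK //; lia.
Qed.

Lemma short_long_two_factor : exists f : rel T,
  two_factor e f /\ consists_of_two_cycles f short_cycle long_cycle.
Proof.
have sz1 : size short_cycle = l.-1 + l.-1.
  by rewrite size_cat size_rev !size_up.
have sz2 : size long_cycle = (l + (width ts + width ts + l).+1).+1.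
  by rewrite /= size_cat size_up size_detours.
have cover z : z \in short_cycle ++ long_cycle.
  have [x x_n [->|->]] := T_cover z; rewrite mem_cat.
    case: (posnP x) => [->|x_gt0]; first by rewrite inE eqxx orbT.
    case: (ltnP x l) => x_l; first by rewrite mem_short_a // x_gt0.
    by rewrite mem_long_a ?orbT //; lia.
  case: (leqP x (n - l)) => x_l; first by rewrite mem_long_b ?orbT.
  by rewrite mem_short_b // x_l.
apply: two_factor_of_cycles => //.
- exact: short_cycle_cycle.
- exact: long_cycle_cycle.
- by rewrite sz1; lia.
- by rewrite sz2; lia.
(* Disjointness comes from counting: the two lists have total length [n + n] and cover all [n + n]
   vertices, so nothing repeats. *)
apply/card_uniqP; rewrite size_cat sz1 sz2.
by rewrite (eq_card (B := T)) ?T_card //; lia.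
Qed.

End Ladder.

(** * The honeycomb toroidal graph as a ladder *)

Section TwoColumns.
Variables (l n : nat).
Hypotheses (n_gt3 : 3 < n) (n_even : ~~ odd n) (l_even : ~~ odd l).

Let n_gt0 : 0 < n. Proof. exact: leq_trans n_gt3. Qed.

(** An odd offset [o] turns the parities of the graph into those of the ladder: flat edges at even
    [x], jumps at odd [x]. *)
Definition vertex (o : nat) (i : 'I_2) (x : nat) : 'I_2 * 'I_n :=
  (i, Ordinal (ltn_pmod (x + o) n_gt0)).

Lemma vertex_mod o i x : vertex o i (x + n) = vertex o i x.
Proof. by congr pair; apply: val_inj; rewrite /= addnAC modnDr. Qed.

Lemma vertex_shift o i (p : 'I_n) x : x + o = p %[mod n] -> vertex o i x = (i, p).
Proof.
by move=> xo_p; congr pair; apply: val_inj; rewrite /= xo_p modn_small.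
Qed.

Lemma vertex_cover o i (p : 'I_n) : exists2 x, x < n & (i, p) = vertex o i x.
Proof.
exists ((p + (n - o %% n)) %% n); first exact: ltn_pmod.
rewrite (@vertex_shift o i p) // modnDml -modnDmr -addnA subnK ?modnDr //.
exact/ltnW/ltn_pmod.
Qed.

Lemma HTG_vertical o i x : HTG 2 n l (vertex o i x) (vertex o i x.+1).
Proof.
rewrite /HTG /HTG_arc /vertical_arc /= eqxx /=; apply/orP; left; apply/orP; left.
by apply/eqP/val_inj; rewrite /= addSn -addn1 -[(_ %% _).+1]addn1 modnDml.
Qed.

Lemma HTG_flat o x : odd o -> ~~ odd x ->
  HTG 2 n l (vertex o ord0 x) (vertex o ord_max x).
Proof.
move=> o_odd x_even; have flat_x : flat_arc (vertex o ord0 x) (vertex o ord_max x).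
  rewrite /flat_arc /= eqxx odd_mod ?oddD ?o_odd ?addbT //; exact: negPf.
by rewrite /HTG /= /HTG_arc flat_x /= ?orbT.
Qed.

Lemma HTG_jump o x : odd o -> odd x ->
  HTG 2 n l (vertex o ord_max x) (vertex o ord0 (x + l)).
Proof.
move=> o_odd x_odd.
have jump_x : jump_arc l (vertex o ord_max x) (vertex o ord0 (x + l)).
  rewrite /jump_arc /= modnDml addnAC eqxx odd_mod ?oddD ?o_odd ?x_odd //.
  exact: negPf.
by rewrite /HTG /= /HTG_arc jump_x !orbT.
Qed.

Lemma ord2P (i : 'I_2) : i = ord0 \/ i = ord_max.
Proof. by case: i => [[|[|k]] lt_k2] //; [left|right]; apply: val_inj. Qed.

Lemma two_columns_cover o z :
  exists2 x, x < n & z = vertex o ord0 x \/ z = vertex o ord_max x.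
Proof.
case: z => i p; have [x x_n ->] := vertex_cover o i p.
by exists x => //; case: (ord2P i) => ->; [left|right].
Qed.

Lemma two_columns_card : #|{: 'I_2 * 'I_n}| = n + n.
Proof. by rewrite card_prod !card_ord mul2n addnn. Qed.

Definition column i := up (vertex 0 i) 0 n.

Lemma mem_column i p : (i, p) \in column i.
Proof. by have [x x_n ->] := vertex_cover 0 i p; apply: mem_up. Qed.

Lemma column_cycle i : cycle (HTG 2 n l) (column i).
Proof.
apply: cycle_up; [exact: HTG_vertical | by lia | exact: (vertex_mod 0 i 0)].
Qed.

End TwoColumns.

(* The short cycle meets the first column in the rows o + x with 0 < x < l. *)
Lemma separating_offset (l n p q : nat) :
    2 < l -> ~~ odd l -> ~~ odd n -> 2 * l <= n ->
    p < n -> q < n -> p != q -> odd p ==> odd q ->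
  exists x y o, [/\ odd o, 0 < x < l, l <= y <= n,
    x + o = p %[mod n] & y + o = q %[mod n]].
Proof.
(* Here [d] is the cyclic distance upwards from [p] to [q]; it remains to choose [x], after which
   [y] is [x + d]. *)
move=> l_gt2 l_even n_even ln p_n q_n pq pq_odd.
have [d [d_gt0 d_n pd d_odd]] : exists d,
    [/\ 0 < d, d < n, p + d = q %[mod n] & odd d = odd (p + q)].
  case: (ltnP p q) => pq'.
    by exists (q - p); split; rewrite ?subnKC //; lia.
  exists (q + n - p); split; try lia.
  by rewrite subnKC ?modnDr //; lia.
have good x : 0 < x < l -> odd (p + n - x) -> l <= x + d <= n -> exists x y o,
    [/\ odd o, 0 < x < l, l <= y <= n, x + o = p %[mod n] & y + o = q %[mod n]].
  move=> x_l o_odd y_n; have x_pn : x <= p + n by clear pd; lia.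
  exists x, (x + d), (p + n - x); split; rewrite ?subnKC ?modnDr //.
  by rewrite addnAC subnKC // addnAC modnDr.
(* Put [p] in the lowest row [x] of the parity that makes [o] odd if [q] then lies outside, and
   otherwise in the highest. For odd [p] this means 2 or [l - 2], which works because [d] is then
   even, hence between 2 and [n - 2]. *)
move: {pd} good; case: (boolP (odd p)) pq_odd => /= p_odd q_odd good.
  case: (ltnP (l - 3) d) => ld; [apply: (good 2) | apply: (good (l - 2))]; lia.
case: (ltnP (l - 2) d) => ld; [apply: (good 1) | apply: (good (l - 1))]; lia.
Qed.

Lemma width_cat l ts1 ts2 : width l (ts1 ++ ts2) = width l ts1 + width l ts2.
Proof. by elim: ts1 => //= t ts1 ->; rewrite addnA. Qed.

Lemma width_nseq l k t : width l (nseq k t) = k * (if t then l + 2 else l).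
Proof. by elim: k => //= k ->. Qed.

Definition separated (T : finType) (e : rel T) (u v : T) : Prop :=
  exists f : rel T, two_factor e f /\
  exists c1 c2 : seq T,
    [/\ consists_of_two_cycles f c1 c2, u \in c1 & v \in c2].

Lemma separated_sym (T : finType) (e : rel T) u v :
  separated e u v -> separated e v u.
Proof.
move=> [f [e_f [c1 [c2 [[f_c1 f_c2 c12 fE] uc1 vc2]]]]].
exists f; split=> //; exists c2, c1; split=> //; split=> //.
  by rewrite disjoint_sym.
by move=> x y; rewrite fE /= orbC.
Qed.

(** * Separating any two vertices *)

Section Separation.
Variables (l n : nat) (ts : seq bool).
Hypotheses (l_gt2 : 2 < l) (l_even : ~~ odd l) (n_even : ~~ odd n).
Hypothesis n_def : n = l + width l ts + l.

Let n_gt3 : 3 < n. Proof. by lia. Qed.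

Let HTG_is_simple : simple_graph (HTG 2 n l).
Proof. by apply: HTG_simple; rewrite ?(negPf l_even). Qed.

Lemma separated_columns (p q : 'I_n) :
  separated (HTG 2 n l) (ord0, p) (ord_max, q).
Proof.
pose c i := column n_gt3 i.
have c_gt2 i : 2 < size (c i) by rewrite size_up ltnW.
have c_cycle i : cycle (HTG 2 n l) (c i) by apply: column_cycle.
have cover z : z \in c ord0 ++ c ord_max.
  case: z => i r; rewrite mem_cat.
  by case: (ord2P i) => ->; rewrite mem_column ?orbT.
have c_uniq : uniq (c ord0 ++ c ord_max).
  apply/card_uniqP; rewrite size_cat !size_up -two_columns_card; exact: eq_card.
have [f [e_f f_c]] := two_factor_of_cycles HTG_is_simple
  (c_cycle _) (c_cycle _) (c_gt2 _) (c_gt2 _) c_uniq cover.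
by exists f; split=> //; exists (c ord0), (c ord_max); split; rewrite ?mem_column.
Qed.

Lemma separated_column_odd i (p q : 'I_n) :
  p != q -> odd p ==> odd q -> separated (HTG 2 n l) (i, p) (i, q).
Proof.
move=> pq pq_odd.
have [|x [y [o [o_odd x_l y_n xp yq]]]] :=
  separating_offset l_gt2 l_even n_even _ (ltn_ord p) (ltn_ord q) pq pq_odd.
  by lia.
have two_factor_at o' : odd o' -> exists f, two_factor (HTG 2 n l) f /\
    consists_of_two_cycles f
      (short_cycle (vertex n_gt3 o' ord0) (vertex n_gt3 o' ord_max) l n)
      (long_cycle (vertex n_gt3 o' ord0) (vertex n_gt3 o' ord_max) l ts).
  move=> o'_odd; apply: short_long_two_factor => //.
  - exact: HTG_vertical.
  - exact: HTG_vertical.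
  - by move=> z; apply: HTG_flat.
  - by move=> z; apply: HTG_jump.
  - exact: vertex_mod.
  - exact: two_columns_card.
  - exact: two_columns_cover.
case: (ord2P i) => {i}->.
  have [f [e_f f_c]] := two_factor_at o o_odd.
  exists f; split=> //; do 2!eexists; split; first exact: f_c.
    by rewrite -(vertex_shift n_gt3 _ xp) mem_short_a.
  rewrite -(vertex_shift n_gt3 _ yq); apply: mem_long_a n_def _ _ => //.
  exact: vertex_mod.
(* The jumps shift the cut in the second column down by l. *)
have [|f [e_f f_c]] := two_factor_at (o + l); first by lia.
exists f; split=> //; do 2!eexists; split; first exact: f_c.
  (* Counted from [o + l], [p] lies in row [x - l], which modulo [n] is [x + (n - l)], and [q] in
     row [y - l]. *)
  rewrite -(@vertex_shift _ n_gt3 (o + l) _ p (x + (n - l))).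
    by apply: mem_short_b; lia.
  by rewrite -xp -[RHS]modnDr; congr (_ %% _); lia.
rewrite -(@vertex_shift _ n_gt3 (o + l) _ q (y - l)).
  by apply: mem_long_b n_def _ _ => //; lia.
by rewrite -yq; congr (_ %% _); lia.
Qed.

Lemma separated_column i (p q : 'I_n) :
  p != q -> separated (HTG 2 n l) (i, p) (i, q).
Proof.
move=> pq; case: (boolP (odd p ==> odd q)) => [|pq_odd].
  exact: separated_column_odd.
(* Here [p] is odd and [q] even, so the parity condition holds after swapping them. *)
apply/separated_sym/separated_column_odd; first by rewrite eq_sym.
by case: (odd p) pq_odd => //; rewrite implybT.
Qed.

End Separation.

Theorem theorem3p3 (l n alpha beta gamma : nat)
    (l_gt2 : 2 < l) (l_even : ~~ odd l)
    (n_def : n = 2 * l + alpha)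
    (alpha_def : alpha = beta * (l + 2) + gamma * l) :
  two_spanning_cyclable (HTG 2 n l).
Proof.
(* With [beta] wide and [gamma] narrow detours the total width is [alpha]. *)
pose ts := nseq beta true ++ nseq gamma false.
have n_width : n = l + width l ts + l by rewrite width_cat !width_nseq; lia.
have n_even : ~~ odd n.
  by rewrite n_def alpha_def !oddD !oddM oddD (negPf l_even) !andbF.
move=> [i p] [j q]; rewrite -/(separated _ _ _).
have [<-|ij] := eqVneq i j.
  rewrite xpair_eqE eqxx; exact: separated_column n_width _ _ _.
move=> _; case: (ord2P i) (ord2P j) ij => -> [] -> // _.
  exact: separated_columns n_width _ _.
apply: separated_sym; exact: separated_columns n_width _ _.
Qed.
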